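(* Let $n\ge 1$ and $k\ge 2$ be integers and put $r=k-1$. There is a bijection between $\mathfrak{M}_{n,k}$ and the set of Kekul\'e structures (perfect matchings) of the benzenoid graph $G_{n,r}$. In particular, the two sets have the same cardinality.
   Context: A $2\times n$ matrix $A=(a_{i,j})$ is weakly increasing if $a_{i,j}\le a_{i',j'}$ whenever $i\le i'$ and $j\le j'$. $\mathfrak{M}_{n,k}$ denotes the set of $2\times n$ weakly increasing matrices with integer entries in $\{1,\dots,k\}$. Benzenoid graph: tile the plane by congruent regular hexagons of width $1$, each having two vertical edges (pointed top and bottom), arranged in horizontal rows with consecutive rows offset by half a width. Index the cells by pairs $(u,i)\in\mathbb{Z}^2$ ($i$ = row, increasing downward), the cell $(u,i)$ having center with horizontal coordinate $u-i/2$; thus cell $(u,i)$ shares an edge with $(u\pm1,i)$, with $(u,i+1)$ and $(u+1,i+1)$ below it, and with $(u-1,i-1)$ and $(u,i-1)$ above it. For integers $n\ge1$, $r\ge1$, let $O_{n,r}$ be the set of cells $(u,i)$ with $0\le i\le r$ and $\max(0,i-r+1)\le u\le \min(n-1+i,\,n)$ (so row $0$ has $n$ cells, rows $1,\dots,r-1$ have $n+1$ cells, row $r$ has $n$ cells; this is the hexagon-shaped benzenoid with sides of $n,2,r,n,2,r$ hexagons, denoted $O\{n,2,r\}$). $G_{n,r}$ is the plane graph whose vertices and edges are the vertices and edges of the hexagons in $O_{n,r}$. A Kekul\'e structure of $G_{n,r}$ is a perfect matching of $G_{n,r}$. *)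

(* Defs.v *)
From mathcomp Require Import all_boot all_algebra.
Set Implicit Arguments. Unset Strict Implicit. Unset Printing Implicit Defensive.

Definition weakly_increasing (n m : nat) (A : 'M['I_m]_(2, n)) : bool :=
  [forall i : 'I_2, forall i' : 'I_2, forall j : 'I_n, forall j' : 'I_n,
     ((i <= i') && (j <= j')) ==> (A i j <= A i' j')].

Definition Mnk (n k : nat) : {set 'M['I_k.+1]_(2, n)} :=
  [set A : 'M['I_k.+1]_(2, n) | [forall i, forall j, 1 <= A i j] && weakly_increasing A].

(* Cell (u,i) belongs to O_{n,r}: 0 <= i <= r and
   max(0, i-r+1) <= u <= min(n-1+i, n).  (i.+1 - r is truncated, i.e. max(0,i-r+1).) *)
Definition inO (n r u i : nat) : bool :=
  [&& i <= r, i.+1 - r <= u & u <= minn (n - 1 + i) n].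

(* Integer coordinates of hexagon vertices.  Hexagons of width 1 with pointed
   top/bottom; a point (x,y) of the plane with x in units of 1/2 and y in units
   of half the side length s.  Cell (u,i) has centre (u - i/2, 3 i s/2), i.e.
   coordinates (2u - i, 3i); we shift by (r+2, 2) to stay in nat.
   Vertices listed cyclically: top, upper-right, lower-right, bottom,
   lower-left, upper-left. *)
Definition hexv (r u i : nat) : seq (nat * nat) :=
  let a := 2 * u + r + 2 - i in
  let b := 3 * i + 2 in
  [:: (a, b - 2); (a.+1, b.-1); (a.+1, b.+1); (a, b + 2); (a.-1, b.+1); (a.-1, b.-1)].

Definition hexedge (r u i : nat) (p q : nat * nat) : bool :=
  let s := hexv r u i in
  [exists j : 'I_6,
     ((p == nth (0,0) s j) && (q == nth (0,0) s (j.+1 %% 6)))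
  || ((q == nth (0,0) s j) && (p == nth (0,0) s (j.+1 %% 6)))].

(* A finite type large enough to contain all vertices of G_{n,r}. *)
Definition Vtx (n r : nat) : finType := ('I_(2 * n + r + 6) * 'I_(3 * r + 6))%type.

Definition coords (n r : nat) (x : Vtx n r) : nat * nat := (val x.1, val x.2).

Definition Gvert (n r : nat) (x : Vtx n r) : bool :=
  [exists u : 'I_n.+1, exists i : 'I_r.+1,
     inO n r u i && (coords x \in hexv r u i)].

Definition Gadj (n r : nat) (x y : Vtx n r) : bool :=
  [exists u : 'I_n.+1, exists i : 'I_r.+1,
     inO n r u i && hexedge r u i (coords x) (coords y)].

Definition Gedge (n r : nat) (e : {set Vtx n r}) : bool :=
  [exists x, exists y, (e == [set x; y]) && Gadj x y].

Definition kekule (n r : nat) (M : {set {set Vtx n r}}) : bool :=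
  [forall e in M, Gedge e] &&
  [forall x, Gvert x ==> (#|[set e in M | x \in e]| == 1)].

Definition Kekule (n r : nat) : {set {set {set Vtx n r}}} := [set M | kekule M].

(* Main.v *)
(* The horizontal zigzags of G are numbered l = 0, ..., r+1 from top to bottom; a
   vertex of a zigzag is either a peak P l v, joined upwards to zigzag l-1, or a
   valley Q l w, joined downwards to zigzag l+1.  Let H l w count the vertical edges
   of a perfect matching M between zigzags l-1 and l that have index < w, after
   adding forced vertical edges outside the corners of G, so that every row of vertical edges
   contains exactly two matched ones.  Walking along a zigzag from its left end, the
   degree conditions express the indicator of each slanted edge in M as a difference
   of values of H, so that M is determined by H, and the functions H that arise are
   exactly those with prescribed boundary values that are weakly increasing in both
   variables and satisfy H (l+1) (w+1) <= H l w + 1.  Such an H takes values in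
   {0, 1, 2}.  Its two superlevel sets {H >= 1} and {H >= 2} are the staircases of the
   first and second row of a matrix A, read from right to left:
     H l w >= 1 iff A 0 (n - w) <= l,   H l w >= 2 iff A 1 (n + 1 - w) < l,
   and the diagonal condition on H says that A 0 j <= A 1 j for all j. *)
Require Import Defs.
From mathcomp Require Import all_boot all_algebra.
From mathcomp Require Import zify.
Set Implicit Arguments. Unset Strict Implicit. Unset Printing Implicit Defensive.

(** * Peaks and valleys of the zigzags *)

(** In the coordinates of [hexv], the valley [Qc r l w] is the upper left corner of cell [(w, l)]
    and the peak [Pc r l v] is the top of cell [(v, l)]. *)
Definition Qc (r l w : nat) : nat * nat := (2 * w + r.+1 - l, 3 * l + 1).
Definition Pc (r l v : nat) : nat * nat := (2 * v + r.+2 - l, 3 * l).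

(** Cut from the index rectangle are the corners missing from the graph: [(0, n.+1)], [(r, 0)],
    [(r.+1, 0)], [(r.+1, 1)] for valleys and, by a half-turn, [(r.+1, 0)], [(1, n.+1)], [(0, n.+1)],
    [(0, n)] for peaks. *)
Definition exQ (n r l w : nat) : bool :=
  [&& l <= r.+1, w <= n.+1, w <= n + l & l < r + w].

Definition exP (n r l v : nat) : bool :=
  [&& l <= r.+1, v <= n.+1, v < n + l & l <= r + v].

(** The three edges at a valley: down, to the peak on its right, to the peak on its left. *)
Definition nQP (l w l' v : nat) : bool :=
  (l' == l.+1) && (v == w) || (l' == l) && ((v == w) || (v.+1 == w)).

(** Peaks and valleys alternate around a cell. The bound on [i] keeps the truncated subtractions
    exact. *)
Lemma hexvE r u i : i <= r ->
  hexv r u i = [:: Pc r i u; Qc r i u.+1; Pc r i.+1 u.+1; Qc r i.+1 u.+1; Pc r i.+1 u; Qc r i u].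
Proof.
move=> ir; rewrite /hexv /Pc /Qc.
by repeat congr (_ :: _); congr (_, _); lia.
Qed.

Lemma inOE n r u i : 0 < n -> inO n r u i = [&& i <= r, i < r + u, u <= n & u < n + i].
Proof. by rewrite /inO; lia. Qed.

Lemma inO_ex n r u i : 0 < n -> 0 < r -> inO n r u i ->
  [/\ i <= r, u <= n,
      [&& exP n r i u, exP n r i.+1 u & exP n r i.+1 u.+1] &
      [&& exQ n r i u, exQ n r i u.+1 & exQ n r i.+1 u.+1]].
Proof.
by move=> n0 r0; rewrite inOE // /exP /exQ => h; split; lia.
Qed.

Lemma hexv_mem n r u i p : 0 < n -> 0 < r -> inO n r u i -> p \in hexv r u i ->
  (exists l w, exQ n r l w /\ p = Qc r l w) \/ (exists l v, exP n r l v /\ p = Pc r l v).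
Proof.
move=> n0 r0 /(inO_ex n0 r0)[ir un /and3P[h1 h2 h3] /and3P[h4 h5 h6]].
rewrite hexvE // !inE.
by case/or4P => [/eqP->|/eqP->|/eqP->|/or3P[/eqP->|/eqP->|/eqP->]]; eauto 6.
Qed.

Lemma hexedge_QP n r u i p q : 0 < n -> 0 < r -> inO n r u i -> hexedge r u i p q ->
  exists l w l' v, [/\ exQ n r l w, exP n r l' v, nQP l w l' v &
    (p, q) = (Qc r l w, Pc r l' v) \/ (q, p) = (Qc r l w, Pc r l' v)].
Proof.
move=> n0 r0 /(inO_ex n0 r0)[ir un /and3P[h1 h2 h3] /and3P[h4 h5 h6]].
rewrite /hexedge hexvE // => /existsP[j].
have K l w l' v p' q' p1 q1 : exQ n r l w -> exP n r l' v -> nQP l w l' v ->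
  p' = Qc r l w -> q' = Pc r l' v -> (p1, q1) = (p', q') \/ (q1, p1) = (p', q') ->
  exists l w l' v, [/\ exQ n r l w, exP n r l' v, nQP l w l' v &
    (p1, q1) = (Qc r l w, Pc r l' v) \/ (q1, p1) = (Qc r l w, Pc r l' v)].
  by move=> hq hp ha -> -> e; exists l, w, l', v.
case: j => [[|[|[|[|[|[|//]]]]]] hj] /=; case/orP => /andP[/eqP-> /eqP->].
(* The candidates are the six sides of the cell in cyclic order from the top. *)
all: first [by apply: (K i u.+1 i u) => //; rewrite ?/nQP ?eqxx ?orbT //; auto
 | by apply: (K i u.+1 i.+1 u.+1) => //; rewrite ?/nQP ?eqxx ?orbT //; auto
 | by apply: (K i.+1 u.+1 i.+1 u.+1) => //; rewrite ?/nQP ?eqxx ?orbT //; auto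
 | by apply: (K i.+1 u.+1 i.+1 u) => //; rewrite ?/nQP ?eqxx ?orbT //; auto
 | by apply: (K i u i.+1 u) => //; rewrite ?/nQP ?eqxx ?orbT //; auto
 | by apply: (K i u i u) => //; rewrite ?/nQP ?eqxx ?orbT //; auto].
Qed.

Lemma hexedge_nth r u i j p q : i <= r -> j < 6 ->
  let s := [:: Pc r i u; Qc r i u.+1; Pc r i.+1 u.+1; Qc r i.+1 u.+1; Pc r i.+1 u; Qc r i u] in
  p = nth (0, 0) s j /\ q = nth (0, 0) s (j.+1 %% 6) \/
  q = nth (0, 0) s j /\ p = nth (0, 0) s (j.+1 %% 6) ->
  hexedge r u i p q.
Proof.
move=> ir j6 s h; rewrite /hexedge hexvE // -/s; apply/existsP; exists (Ordinal j6).
by apply/orP; case: h => -[-> ->]; [left|right]; rewrite !eqxx.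
Qed.

(** The edge is the left side of cell [(w, l)] and the right side of cell [(w.-1, l)]; the boundary
    removes at most one of them. The slanted edges follow likewise. *)
Lemma inO_down n r l w : 0 < n -> 0 < r -> exQ n r l w -> exP n r l.+1 w ->
  inO n r w l || (0 < w) && inO n r w.-1 l.
Proof. by move=> n0 r0; rewrite /exQ /exP !inOE //; lia. Qed.

Lemma inO_right n r l w : 0 < n -> 0 < r -> exQ n r l w -> exP n r l w ->
  inO n r w l || [&& 0 < w, 0 < l & inO n r w.-1 l.-1].
Proof. by move=> n0 r0; rewrite /exQ /exP !inOE //; lia. Qed.

Lemma inO_left n r l v : 0 < n -> 0 < r -> exQ n r l v.+1 -> exP n r l v ->
  inO n r v l || (0 < l) && inO n r v l.-1.
Proof. by move=> n0 r0; rewrite /exQ /exP !inOE //; lia. Qed.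

Lemma QP_hexedge n r l w l' v : 0 < n -> 0 < r ->
  exQ n r l w -> exP n r l' v -> nQP l w l' v ->
  exists u i, inO n r u i /\ hexedge r u i (Qc r l w) (Pc r l' v).
Proof.
have K u i j p q : inO n r u i -> j < 6 ->
    let s := [:: Pc r i u; Qc r i u.+1; Pc r i.+1 u.+1; Qc r i.+1 u.+1; Pc r i.+1 u; Qc r i u] in
    p = nth (0, 0) s j /\ q = nth (0, 0) s (j.+1 %% 6) \/
    q = nth (0, 0) s j /\ p = nth (0, 0) s (j.+1 %% 6) ->
    exists u i, inO n r u i /\ hexedge r u i p q.
  move=> h j6 s hs; exists u, i; split=> //; case/and3P: h => hi _ _.
  exact: (hexedge_nth hi j6).
move=> n0 r0 hq hp /orP[/andP[/eqP e1 /eqP e2]|/andP[/eqP e1 /orP[]/eqP e2]];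
  subst l'.
(* Sides are numbered clockwise from the upper right one, so the two cells at an edge see it as
   opposite sides: 4 and 1, 5 and 2, 0 and 3. *)
- subst v; case/orP: (inO_down n0 r0 hq hp) => [h|/andP[w0 h]].
    by apply: (K _ _ 4 _ _ h) => //=; right.
  by apply: (K _ _ 1 _ _ h) => //=; left; rewrite prednK.
- subst v; case/orP: (inO_right n0 r0 hq hp) => [h|/and3P[w0 l0 h]].
    by apply: (K _ _ 5 _ _ h) => //=; left.
  by apply: (K _ _ 2 _ _ h) => //=; right; rewrite !prednK.
- subst w; case/orP: (inO_left n0 r0 hq hp) => [h|/andP[l0 h]].
    by apply: (K _ _ 0 _ _ h) => //=; right.
  by apply: (K _ _ 3 _ _ h) => //=; left; rewrite !prednK.
Qed.

(** Tried in turn are the cells having the valley as upper left, upper right and bottom corner. *)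
Lemma Q_hexv n r l w : 0 < n -> 0 < r -> exQ n r l w ->
  exists u i, inO n r u i /\ Qc r l w \in hexv r u i.
Proof.
move=> n0 r0 hq.
have [h|h] := boolP (inO n r w l).
  exists w, l; split=> //; case/and3P: (h) => hl _ _.
  by rewrite hexvE // !inE eqxx ?orbT.
have w0 : 0 < w by move: h hq; rewrite !inOE // /exQ; lia.
have [h'|h'] := boolP (inO n r w.-1 l).
  exists w.-1, l; split=> //; case/and3P: (h') => hl _ _.
  by rewrite hexvE // !inE prednK // eqxx ?orbT.
have [h'' l0] : inO n r w.-1 l.-1 /\ 0 < l by move: h h' hq; rewrite !inOE // /exQ; lia.
exists w.-1, l.-1; split=> //; case/and3P: (h'') => hl _ _.
by rewrite hexvE // !inE !prednK // eqxx ?orbT.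
Qed.

Lemma P_hexv n r l v : 0 < n -> 0 < r -> exP n r l v ->
  exists u i, inO n r u i /\ Pc r l v \in hexv r u i.
Proof.
move=> n0 r0 hp.
have [h|h] := boolP (inO n r v l).
  exists v, l; split=> //; case/and3P: (h) => hl _ _.
  by rewrite hexvE // !inE eqxx ?orbT.
have l0 : 0 < l by move: h hp; rewrite !inOE // /exP; lia.
have [h'|h'] := boolP (inO n r v l.-1).
  exists v, l.-1; split=> //; case/and3P: (h') => hl _ _.
  by rewrite hexvE // !inE prednK // eqxx ?orbT.
have [h'' v0] : inO n r v.-1 l.-1 /\ 0 < v by move: h h' hp; rewrite !inOE // /exP; lia.
exists v.-1, l.-1; split=> //; case/and3P: (h'') => hl _ _.
by rewrite hexvE // !inE !prednK // eqxx ?orbT.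
Qed.

Lemma Qc_inj r l w l2 w2 : l <= r.+1 -> l2 <= r.+1 -> Qc r l w = Qc r l2 w2 -> l = l2 /\ w = w2.
Proof. by rewrite /Qc => h1 h2 []; lia. Qed.

Lemma Pc_inj r l v l2 v2 : l <= r.+1 -> l2 <= r.+1 -> Pc r l v = Pc r l2 v2 -> l = l2 /\ v = v2.
Proof. by rewrite /Pc => h1 h2 []; lia. Qed.

Lemma Qc_neq_Pc r l w l' v : Qc r l w <> Pc r l' v.
Proof. by rewrite /Qc /Pc => -[]; lia. Qed.

(** * Vertices, adjacency and incidence in [G] *)

Lemma coords_inj n r : injective (@coords n r).
Proof. by move=> [a b] [c d] [] /val_inj -> /val_inj ->. Qed.

Lemma coords_ex n r p : p.1 < 2 * n + r + 6 -> p.2 < 3 * r + 6 ->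
  exists x : Vtx n r, coords x = p.
Proof. by case: p => a b /= ha hb; exists (Ordinal ha, Ordinal hb). Qed.

Lemma Q_vtx n r l w : exQ n r l w -> exists x : Vtx n r, coords x = Qc r l w.
Proof. by rewrite /exQ => h; apply: coords_ex; rewrite /=; lia. Qed.

Lemma P_vtx n r l v : exP n r l v -> exists x : Vtx n r, coords x = Pc r l v.
Proof. by rewrite /exP => h; apply: coords_ex; rewrite /=; lia. Qed.

Lemma GvertP n r (x : Vtx n r) : 0 < n -> 0 < r ->
  Gvert x <-> (exists l w, exQ n r l w /\ coords x = Qc r l w) \/
              (exists l v, exP n r l v /\ coords x = Pc r l v).
Proof.
move=> n0 r0; split.
  by case/existsP => u /existsP[i /andP[hO hx]]; apply: hexv_mem hO hx.
have K u i : inO n r u i -> coords x \in hexv r u i -> Gvert x.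
  move=> hO hx; have [hi hu _ _] := inO_ex n0 r0 hO.
  rewrite -ltnS in hi; rewrite -ltnS in hu.
  by apply/existsP; exists (Ordinal hu); apply/existsP; exists (Ordinal hi); rewrite hO.
case=> -[l [w [h e]]].
  by have [u [i [hO hx]]] := Q_hexv n0 r0 h; apply: K hO _; rewrite e.
by have [u [i [hO hx]]] := P_hexv n0 r0 h; apply: K hO _; rewrite e.
Qed.

Lemma Gadj_QP n r (x y : Vtx n r) : 0 < n -> 0 < r -> Gadj x y ->
  exists l w l' v, [/\ exQ n r l w, exP n r l' v, nQP l w l' v &
    coords x = Qc r l w /\ coords y = Pc r l' v \/
    coords y = Qc r l w /\ coords x = Pc r l' v].
Proof.
move=> n0 r0 /existsP[u /existsP[i /andP[hO hx]]].
have [l [w [l' [v [h1 h2 h3 h4]]]]] := hexedge_QP n0 r0 hO hx.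
by exists l, w, l', v; split=> //; case: h4 => h4; [left|right]; split;
  first [exact: (congr1 fst h4) | exact: (congr1 snd h4)].
Qed.

Lemma QP_Gadj n r (x y : Vtx n r) l w l' v : 0 < n -> 0 < r ->
  exQ n r l w -> exP n r l' v -> nQP l w l' v ->
  coords x = Qc r l w -> coords y = Pc r l' v -> Gadj x y.
Proof.
move=> n0 r0 h1 h2 h3 e1 e2.
have [u [i [hO hx]]] := QP_hexedge n0 r0 h1 h2 h3.
have [hi hu _ _] := inO_ex n0 r0 hO.
rewrite -ltnS in hi; rewrite -ltnS in hu.
by apply/existsP; exists (Ordinal hu); apply/existsP; exists (Ordinal hi); rewrite hO e1 e2.
Qed.

Lemma set2_inj (T : finType) (x y z : T) : [set x; y] = [set x; z] -> y = z.
Proof.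
move=> e; have := set22 x y; rewrite e !inE => /orP[]/eqP // yx.
by have := set22 x z; rewrite -e yx !inE orbb => /eqP.
Qed.

Lemma Gedge2 n r (e : {set Vtx n r}) x : Gedge e -> x \in e -> exists y, e = [set x; y].
Proof.
case/existsP => a /existsP[b /andP[/eqP-> _]]; rewrite !inE => /orP[]/eqP->.
  by exists b.
by exists a; rewrite setUC.
Qed.

Lemma card_incident n r (M : {set {set Vtx n r}}) (x : Vtx n r) :
  {in M, forall e, Gedge e} ->
  #|[set e in M | x \in e]| = #|[set y | [set x; y] \in M]|.
Proof.
move=> hM; rewrite -(card_imset _ (@set2_inj _ x)); apply: eq_card => e.
rewrite !inE; apply/andP/imsetP.
  move=> [eM xe]; have [y ey] := Gedge2 (hM _ eM) xe.
  by exists y => //; rewrite inE -ey.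
by move=> [y]; rewrite inE => yM ->; rewrite set21.
Qed.

(** * Degree conditions *)

(** Stated on coordinates, so that it also makes sense, and is false, when a valley or peak lies
    outside the graph. *)
Definition joined n r (M : {set {set Vtx n r}}) (p q : nat * nat) : bool :=
  [exists x, exists y, [&& coords x == p, coords y == q & [set x; y] \in M]].

Lemma joinedE n r (M : {set {set Vtx n r}}) x y :
  joined M (coords x) (coords y) = ([set x; y] \in M).
Proof.
apply/existsP/idP => [[x' /existsP[y' /and3P[/eqP/coords_inj-> /eqP/coords_inj->]]]//|h].
by exists x; apply/existsP; exists y; rewrite !eqxx.
Qed.

Lemma joinedC n r (M : {set {set Vtx n r}}) p q : joined M p q = joined M q p.
Proof.
wlog suff : p q / joined M p q -> joined M q p by move=> K; apply/idP/idP; apply: K.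
case/existsP => x /existsP[y /and3P[h1 h2 h3]].
by apply/existsP; exists y; apply/existsP; exists x; rewrite h1 h2 setUC.
Qed.

(** Double counting of the pairs [(y, c)] with [coords y == c]: [s] has no repetition and [coords]
    is injective. *)
Lemma card_joined n r (M : {set {set Vtx n r}}) (x : Vtx n r) (s : seq (nat * nat)) :
  uniq s -> (forall y, [set x; y] \in M -> coords y \in s) ->
  #|[set y | [set x; y] \in M]| = \sum_(c <- s) joined M (coords x) c.
Proof.
move=> us hs; rewrite -sum1_card.
transitivity (\sum_(y in [set y | [set x; y] \in M]) \sum_(c <- s) (coords y == c)).
  apply: eq_bigr => y; rewrite inE => /hs ys.
  by rewrite -big_mkcond sum1_count (eq_count (a2 := pred1 (coords y))) ?count_uniq_mem ?ys // => c;
    rewrite /= eq_sym.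
rewrite exchange_big; apply: eq_bigr => c _ /=.
case: (boolP (joined M (coords x) c)) => [/existsP[x' /existsP[y]]|].
  case/and3P => /eqP/coords_inj-> /eqP<- hy.
  rewrite (bigD1 y) ?inE //= eqxx big1 // => z /andP[_ zy].
  by case: eqP => // /coords_inj e; rewrite e eqxx in zy.
move=> hn; rewrite big1 // => y; rewrite inE => hy.
by case: eqP => // e; rewrite -e joinedE hy in hn.
Qed.

Lemma nQP_cases l w l' v : nQP l w l' v ->
  [\/ l' = l.+1 /\ v = w, l' = l /\ v = w | l' = l /\ w = v.+1].
Proof.
case/orP=> [/andP[/eqP-> /eqP->]|/andP[/eqP-> /orP[]/eqP->]]; first exact: Or31.
  exact: Or32.
exact: Or33.
Qed.

Lemma Gedge_QP n r (e : {set Vtx n r}) : 0 < n -> 0 < r -> Gedge e ->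
  exists c d l w l' v, [/\ e = [set c; d], coords c = Qc r l w, coords d = Pc r l' v &
    [/\ exQ n r l w, exP n r l' v & nQP l w l' v]].
Proof.
move=> n0 r0 /existsP[a /existsP[b /andP[/eqP-> /(Gadj_QP n0 r0)]]].
move=> [l [w [l' [v [h1 h2 h3 [] [ea eb]]]]]].
  by exists a, b, l, w, l', v.
by exists b, a, l, w, l', v; split=> //; apply: setUC.
Qed.

Lemma joined_ex n r (M : {set {set Vtx n r}}) l w l' v : 0 < n -> 0 < r ->
  {in M, forall e, Gedge e} -> joined M (Qc r l w) (Pc r l' v) ->
  [/\ exQ n r l w, exP n r l' v & nQP l w l' v].
Proof.
move=> n0 r0 hM /existsP[x /existsP[y /and3P[/eqP ex /eqP ey xyM]]].
(* The size of [Vtx] bounds the zigzag indices, as [Qc_inj] and [Pc_inj] require. *)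
have hl : l <= r.+1 by move: (ltn_ord x.2) (congr1 snd ex) => /=; lia.
have hl' : l' <= r.+1 by move: (ltn_ord y.2) (congr1 snd ey) => /=; lia.
have [c [d [l1 [w1 [l2 [v2 [ecd ec ed [h1 h2 h3]]]]]]]] := Gedge_QP n0 r0 (hM _ xyM).
have l1r : l1 <= r.+1 by case/and4P: h1.
have l2r : l2 <= r.+1 by case/and4P: h2.
have xc : x = c.
  have := set21 x y; rewrite ecd !inE => /orP[/eqP//|/eqP xd].
  by case: (@Qc_neq_Pc r l w l2 v2); rewrite -ex -ed xd.
have yd : y = d by apply: (@set2_inj _ x); rewrite ecd xc.
move: ec ed; rewrite -xc -yd ex ey => /(Qc_inj hl l1r)[-> ->] /(Pc_inj hl' l2r)[-> ->].
by split.
Qed.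

Lemma eq_joined n r (M N : {set {set Vtx n r}}) : 0 < n -> 0 < r ->
  {in M, forall e, Gedge e} -> {in N, forall e, Gedge e} ->
  (forall l w l' v, exQ n r l w -> exP n r l' v -> nQP l w l' v ->
     joined M (Qc r l w) (Pc r l' v) = joined N (Qc r l w) (Pc r l' v)) ->
  M = N.
Proof.
move=> n0 r0 hM hN eMN.
have key e : Gedge e -> (e \in M) = (e \in N).
  case/(Gedge_QP n0 r0) => c [d [l [w [l' [v [-> ec ed [h1 h2 h3]]]]]]].
  by rewrite -!joinedE ec ed eMN.
by apply/setP => e; apply/idP/idP => he; [rewrite -key ?hM | rewrite key ?hN].
Qed.

Lemma card_Q n r (M : {set {set Vtx n r}}) x l w : 0 < n -> 0 < r ->
  {in M, forall e, Gedge e} -> exQ n r l w -> coords x = Qc r l w ->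
  #|[set e in M | x \in e]| =
    joined M (Qc r l w) (Pc r l.+1 w) + joined M (Qc r l w) (Pc r l w)
    + (if w is w'.+1 then joined M (Qc r l w) (Pc r l w') : nat else 0).
Proof.
move=> n0 r0 hM hq ex; rewrite card_incident //.
pose s := [:: Pc r l.+1 w; Pc r l w] ++ (if w is w'.+1 then [:: Pc r l w'] else [::]).
rewrite (@card_joined _ _ _ _ s).
- rewrite big_cat /= !big_cons big_nil ex addn0.
  by case: w {hq ex s} => [|w]; rewrite ?big_nil // big_cons big_nil addn0.
- have hl : l <= r.+1 by case/and4P: hq.
  rewrite /s /Pc /=; case: w {hq ex s} => [|w] /=; rewrite ?inE ?xpair_eqE ?negb_or ?andbT; lia.
- move=> y xyM; move: (xyM); rewrite -joinedE ex.
  have [c [d [l1 [w1 [l2 [v2 [ecd ec ed [h1 h2 h3]]]]]]]] := Gedge_QP n0 r0 (hM _ xyM).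
  have xc : x = c.
    have := set21 x y; rewrite ecd !inE => /orP[/eqP//|/eqP xd].
    by case: (@Qc_neq_Pc r l w l2 v2); rewrite -ex -ed xd.
  have yd : y = d by apply: (@set2_inj _ x); rewrite ecd xc.
  rewrite yd ed => /(joined_ex n0 r0 hM)[_ _ /nQP_cases].
  by case=> -[e1 e2]; rewrite /s e1 e2 mem_cat !inE eqxx ?orbT.
Qed.

Lemma card_P n r (M : {set {set Vtx n r}}) x l v : 0 < n -> 0 < r ->
  {in M, forall e, Gedge e} -> exP n r l v -> coords x = Pc r l v ->
  #|[set e in M | x \in e]| =
    (if l is l'.+1 then joined M (Qc r l' v) (Pc r l v) : nat else 0)
    + joined M (Qc r l v) (Pc r l v) + joined M (Qc r l v.+1) (Pc r l v).
Proof.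
move=> n0 r0 hM hp ex; rewrite card_incident //.
pose s := (if l is l'.+1 then [:: Qc r l' v] else [::]) ++ [:: Qc r l v; Qc r l v.+1].
rewrite (@card_joined _ _ _ _ s).
- rewrite big_cat /= !big_cons big_nil ex !(joinedC _ (Pc _ _ _)) addn0 -addnA.
  by case: l {hp ex s} => [|l]; rewrite ?big_nil // big_cons big_nil addn0 (joinedC _ (Pc _ _ _)).
- have hl : l <= r.+1 by case/and4P: hp.
  rewrite /s /Qc /=; case: l hl {hp ex s} => [|l] /= hl;
    rewrite ?inE ?xpair_eqE ?negb_or ?andbT; lia.
- move=> y xyM; move: (xyM); rewrite -joinedE ex.
  have [d [c [l1 [w1 [l2 [v2 [ecd ed ec [h1 h2 h3]]]]]]]] := Gedge_QP n0 r0 (hM _ xyM).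
  have xc : x = c.
    have := set21 x y; rewrite ecd !inE => /orP[/eqP xd|/eqP//].
    by case: (@Qc_neq_Pc r l1 w1 l v); rewrite -ex -ed xd.
  have yd : y = d by apply: (@set2_inj _ x); rewrite ecd xc setUC.
  rewrite yd ed joinedC => /(joined_ex n0 r0 hM)[_ _ /nQP_cases].
  by case=> -[e1 e2]; rewrite /s e1 e2 mem_cat !inE eqxx ?orbT.
Qed.

Lemma kekule_deg n r (M : {set {set Vtx n r}}) : 0 < n -> 0 < r ->
  {in M, forall e, Gedge e} ->
  kekule M <->
  (forall l w, exQ n r l w -> joined M (Qc r l w) (Pc r l.+1 w) + joined M (Qc r l w) (Pc r l w)
    + (if w is w'.+1 then joined M (Qc r l w) (Pc r l w') : nat else 0) = 1) /\
  (forall l v, exP n r l v -> (if l is l'.+1 then joined M (Qc r l' v) (Pc r l v) : nat else 0)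
    + joined M (Qc r l v) (Pc r l v) + joined M (Qc r l v.+1) (Pc r l v) = 1).
Proof.
move=> n0 r0 hM; split.
  case/andP=> _ /forallP hdeg; split=> l w h.
    have [x ex] := Q_vtx h; rewrite -(card_Q n0 r0 hM h ex).
    by apply/eqP/(implyP (hdeg x)); apply/GvertP => //; left; exists l, w.
  have [x ex] := P_vtx h; rewrite -(card_P n0 r0 hM h ex).
  by apply/eqP/(implyP (hdeg x)); apply/GvertP => //; right; exists l, w.
move=> [hQ hP]; apply/andP; split; first by apply/forall_inP.
apply/forallP => x; apply/implyP => /(GvertP _ n0 r0)[|] [l [w [h ex]]]; apply/eqP.
  by rewrite (card_Q n0 r0 hM h ex); apply: hQ.
by rewrite (card_P n0 r0 hM h ex); apply: hP.
Qed.

(** * Height functions *)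

(** In rows 0 and [r.+2] all matched vertical edges are forced ones: those of index [n] and [n.+1]
    at the top, 0 and 1 at the bottom. *)
Record height (n r : nat) (H : nat -> nat -> nat) : Prop := Height {
  height_left : forall l, l <= r.+2 -> H l 0 = 0;
  height_top : forall w, w <= n.+2 -> H 0 w = (n < w) + (n.+1 < w);
  height_bottom : forall w, w <= n.+2 -> H r.+2 w = (0 < w) + (1 < w);
  height_row : forall l w, l <= r.+2 -> w <= n.+1 -> H l w <= H l w.+1;
  height_col : forall l w, l <= r.+1 -> w <= n.+2 -> H l w <= H l.+1 w;
  height_diag : forall l w, l <= r.+1 -> w <= n.+1 -> H l.+1 w.+1 <= (H l w).+1 }.

Lemma height_row_le n r H l w w' : height n r H -> l <= r.+2 -> w <= w' <= n.+2 ->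
  H l w <= H l w'.
Proof.
move=> hH hl /andP[]; elim: w' => [|w' IH]; first by rewrite leqn0 => /eqP->.
rewrite leq_eqVlt => /orP[/eqP-> //|ww' w'n].
by apply: leq_trans (IH _ _) (height_row hH hl _); lia.
Qed.

Lemma height_col_le n r H l l' w : height n r H -> w <= n.+2 -> l <= l' <= r.+2 ->
  H l w <= H l' w.
Proof.
move=> hH hw /andP[]; elim: l' => [|l' IH]; first by rewrite leqn0 => /eqP->.
rewrite leq_eqVlt => /orP[/eqP-> //|ll' l'n].
by apply: leq_trans (IH _ _) (height_col hH _ hw); lia.
Qed.

(** Columns increase downwards, and this one is 2 both at the top and at the bottom. *)
Lemma height_right n r H l : height n r H -> l <= r.+2 -> H l n.+2 = 2.
Proof.
move=> hH hl; have h1 := height_top hH (leqnn n.+2); have h2 := height_bottom hH (leqnn n.+2).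
have := height_col_le hH (leqnn n.+2) (l := 0) (l' := l).
have := height_col_le hH (leqnn n.+2) (l := l) (l' := r.+2).
by rewrite h1 h2; lia.
Qed.

Lemma height_le2 n r H l w : height n r H -> l <= r.+2 -> w <= n.+2 -> H l w <= 2.
Proof.
by move=> hH hl hw; rewrite -(height_right hH hl); apply: (height_row_le hH) => //; rewrite hw /=.
Qed.

(* For a height function H, the indicators in the matching of the edges
   Q (l-1) w -- P l w, Q l (w+1) -- P l w and Q l w -- P l w, respectively. *)
Definition sel_down (H : nat -> nat -> nat) l w : bool := H l w < H l w.+1.
Definition sel_left (H : nat -> nat -> nat) l w : bool := H l w.+1 < H l.+1 w.+1.
Definition sel_right (H : nat -> nat -> nat) l w : bool := H l.+1 w.+1 <= H l w.

(** The chain [H l w <= H l w.+1 <= H l.+1 w.+1 <= (H l w).+1] rises at its first step, at its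
    second step or at neither: the three edges at the peak. *)
Lemma height_peak n r H l w : height n r H -> l <= r.+1 -> w <= n.+1 ->
  sel_down H l w + sel_right H l w + sel_left H l w = 1.
Proof.
move=> hH hl hw; rewrite /sel_down /sel_right /sel_left.
have := height_row hH (leqW hl) hw; have := height_col hH hl (w := w.+1) hw.
by have := height_diag hH hl hw; lia.
Qed.

(** The same argument for the chain through [H l.+1 w]; at [w = 0] its first step is [0 <= 0], and
    there is no left edge. *)
Lemma height_valley n r H l w : height n r H -> l <= r.+1 -> w <= n.+1 ->
  sel_down H l.+1 w + sel_right H l w + (if w is w'.+1 then sel_left H l w' : nat else 0) = 1.
Proof.
move=> hH hl hw; rewrite /sel_down /sel_right /sel_left.
have := height_row hH (l := l.+1) hl hw; have := height_col hH hl (leqW hw).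
have := height_diag hH hl hw; case: w hw => [|w] hw; last by lia.
by rewrite !(height_left hH) ?(leqW hl) //; lia.
Qed.

(** * Heights recovered from edge indicators *)

Definition heights_of (V : nat -> nat -> bool) l w : nat := \sum_(0 <= i < w) V l i.

Lemma heights_ofS V l w : heights_of V l w.+1 = heights_of V l w + V l w.
Proof. by rewrite /heights_of big_nat_recr. Qed.

Lemma heights_of_down V l w : sel_down (heights_of V) l w = V l w.
Proof. by rewrite /sel_down heights_ofS; lia. Qed.

Section HeightsOf.

(** [V l w] stands for the vertical edge above peak [w] of zigzag [l], [b l w] for its slanted edge
    to valley [w], [a l w] for the one to valley [w.+1]. *)
Variables (n r : nat) (V a b : nat -> nat -> bool).
Hypotheses (Vtop : forall w, w <= n.+1 -> V 0 w = (n <= w))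
  (Vbot : forall w, w <= n.+1 -> V r.+2 w = (w <= 1))
  (hP : forall l w, l <= r.+1 -> w <= n.+1 -> V l w + b l w + a l w = 1)
  (hQ : forall l w, l <= r.+1 -> w <= n.+1 ->
    V l.+1 w + b l w + (if w is w'.+1 then a l w' : nat else 0) = 1).

(** Subtracting [hQ] from [hP] gives [V l.+1 w - V l w = a l w - a l w.-1], which telescopes along
    the zigzag. *)
Lemma heights_of_addl l w : l <= r.+1 -> w <= n.+1 ->
  heights_of V l.+1 w.+1 = heights_of V l w.+1 + a l w.
Proof.
move=> hl; elim: w => [|w IH] hw.
  by rewrite !heights_ofS /heights_of !big_geq //; move: (hP hl hw) (hQ hl hw); lia.
rewrite heights_ofS IH 1?ltnW // [in RHS]heights_ofS.
by move: (hP hl hw) (hQ hl hw); lia.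
Qed.

Lemma heights_of_addr l w : l <= r.+1 -> w <= n.+1 ->
  heights_of V l.+1 w.+1 + b l w = (heights_of V l w).+1.
Proof.
by move=> hl hw; rewrite heights_of_addl // heights_ofS; move: (hP hl hw); lia.
Qed.

Lemma heights_of_height : height n r (heights_of V).
Proof.
split.
- by move=> l _; rewrite /heights_of big_geq.
- elim=> [|w IH] hw; first by rewrite /heights_of big_geq.
  by rewrite heights_ofS IH ?Vtop //; lia.
- elim=> [|w IH] hw; first by rewrite /heights_of big_geq.
  by rewrite heights_ofS IH ?Vbot //; lia.
- by move=> l w hl hw; rewrite heights_ofS leq_addr.
- move=> l [|w] hl hw; first by rewrite /heights_of !big_geq.
  by rewrite heights_of_addl // leq_addr.
- by move=> l w hl hw; rewrite -heights_of_addr // leq_addr.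
Qed.

Lemma heights_of_left l w : l <= r.+1 -> w <= n.+1 -> sel_left (heights_of V) l w = a l w.
Proof. by move=> hl hw; rewrite /sel_left heights_of_addl //; lia. Qed.

Lemma heights_of_right l w : l <= r.+1 -> w <= n.+1 -> sel_right (heights_of V) l w = b l w.
Proof. by move=> hl hw; rewrite /sel_right; move: (heights_of_addr hl hw); lia. Qed.

End HeightsOf.

(** * Height functions and monotone matrices *)

(** Natural column indices allow [n - w] without a bound; the default 0 is for columns out of
    range. *)
Definition ent n m (A : 'M['I_m]_(2, n)) (i : 'I_2) (j : nat) : nat :=
  if insub j is Some j' then A i j' else 0.

Lemma ent_ord n m (A : 'M['I_m]_(2, n)) i (j : 'I_n) : ent A i j = A i j.
Proof. by rewrite /ent valK. Qed.

(** Monotonicity along rows and down columns suffices: go along the first row, then down. *)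
Lemma MnkP n k (A : 'M['I_k.+1]_(2, n)) :
  A \in Mnk n k <->
  [/\ forall i j, j < n -> 0 < ent A i j <= k,
      forall i j j', j <= j' < n -> ent A i j <= ent A i j' &
      forall j, j < n -> ent A ord0 j <= ent A ord_max j].
Proof.
rewrite inE; split.
  case/andP => /forallP h1 /forallP h2.
  have mon (i i' : 'I_2) (j j' : 'I_n) : i <= i' -> j <= j' -> A i j <= A i' j'.
    move=> hi hj; move/forallP: (h2 i) => /(_ i')/forallP/(_ j)/forallP/(_ j')/implyP.
    by apply; rewrite hi hj.
  split.
  - move=> i j hj; rewrite -[j]/(val (Ordinal hj)) ent_ord (forallP (h1 i)) /=.
    by rewrite -ltnS ltn_ord.
  - move=> i j j' /andP[jj' hj']; have hj := leq_ltn_trans jj' hj'.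
    by rewrite -[j]/(val (Ordinal hj)) -[j']/(val (Ordinal hj')) !ent_ord mon.
  - by move=> j hj; rewrite -[j]/(val (Ordinal hj)) !ent_ord mon.
case=> h1 h2 h3; apply/andP; split.
  by apply/forallP => i; apply/forallP => j; rewrite -ent_ord; case/andP: (h1 i j (ltn_ord j)).
apply/forallP => i; apply/forallP => i'; apply/forallP => j; apply/forallP => j'.
apply/implyP => /andP[ii' jj']; rewrite -!ent_ord.
have jj'n : j <= j' < n by rewrite jj' ltn_ord.
case: (eqVneq i i') => [->|ne]; first exact: h2.
have -> : i = ord0 by apply/val_inj; move: ii' ne (ltn_ord i'); rewrite -val_eqE /=; lia.
have -> : i' = ord_max by apply/val_inj; move: ii' ne (ltn_ord i'); rewrite -val_eqE /=; lia.
exact: leq_trans (h2 _ _ _ jj'n) (h3 _ (ltn_ord j')).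
Qed.

(* The first l at which H l w reaches 1, resp. 2; the values m + 3 and m + 4 stand for
   infinity, m + 4 > m + 3 making [thr1_lt_thr2] hold at w = 0 too. *)
Definition thr1 n m (A : 'M['I_m]_(2, n)) w : nat :=
  if w == 0 then m.+3 else if w <= n then ent A ord0 (n - w) else 0.
Definition thr2 n m (A : 'M['I_m]_(2, n)) w : nat :=
  if w <= 1 then m.+4 else if w <= n.+1 then (ent A ord_max (n.+1 - w)).+1 else 0.
Definition mxH n m (A : 'M['I_m]_(2, n)) l w : nat := (thr1 A w <= l) + (thr2 A w <= l).

Section MxH.
Variables (n r : nat) (A : 'M['I_r.+2]_(2, n)).
Hypothesis (hA : A \in Mnk n r.+1).

Lemma thr1_anti w : thr1 A w.+1 <= thr1 A w.
Proof.
case/MnkP: hA => h1 h2 h3; rewrite /thr1 /=.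
case: (ltnP w n) => // hw; case: eqP => [->|w0].
  by have := h1 ord0 (n - 1); lia.
by rewrite (ltnW hw); apply: h2; lia.
Qed.

Lemma thr2_anti w : thr2 A w.+1 <= thr2 A w.
Proof.
case/MnkP: hA => h1 h2 h3; rewrite /thr2 !ltnS leqn0.
case: eqP => [->//|w0]; case: (leqP w n) => // hw.
case: (ltnP 1 w) => w1.
  by rewrite (leqW hw) ltnS; apply: h2; lia.
by have := h1 ord_max (n.+1 - w.+1); lia.
Qed.

(** Both sides read the same column, as [n - w = n.+1 - w.+1]; the column condition becomes strict
    by the successor in [thr2]. *)
Lemma thr1_lt_thr2 w : w <= n -> thr1 A w < thr2 A w.+1.
Proof.
case/MnkP: hA => h1 h2 h3 hw; rewrite /thr1 /thr2 !ltnS leqn0 hw subSS.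
by case: eqP => // w0; apply: h3; lia.
Qed.

Lemma thr1_gt0 w : (0 < thr1 A w) = (w <= n).
Proof.
case/MnkP: hA => h1 h2 h3; rewrite /thr1; case: eqP => [->//|w0].
by case: (leqP w n) => // hw; have := h1 ord0 (n - w); lia.
Qed.

Lemma thr2_gt0 w : (0 < thr2 A w) = (w <= n.+1).
Proof. by rewrite /thr2; case: (leqP w 1) => [|_]; [lia | case: (leqP w n.+1)]. Qed.

Lemma thr1_bot w : (thr1 A w <= r.+2) = (0 < w).
Proof.
case/MnkP: hA => h1 h2 h3; rewrite /thr1; case: eqP => [->|w0]; first by lia.
by case: (leqP w n) => // hw; [have := h1 ord0 (n - w)|]; lia.
Qed.

Lemma thr2_bot w : (thr2 A w <= r.+2) = (1 < w).
Proof.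
case/MnkP: hA => h1 h2 h3; rewrite /thr2; case: (leqP w 1) => [|w1]; first by lia.
by case: (leqP w n.+1) => // hw; have := h1 ord_max (n.+1 - w); lia.
Qed.

Lemma mxH_height : height n r (mxH A).
Proof.
split.
- by move=> l hl; rewrite /mxH /thr1 /thr2 /=; lia.
- by move=> w hw; rewrite /mxH !leqn0 !eqn0Ngt thr1_gt0 thr2_gt0 -!ltnNge.
- by move=> w hw; rewrite /mxH thr1_bot thr2_bot.
- by move=> l w _ _; rewrite /mxH; move: (thr1_anti w) (thr2_anti w); lia.
- by move=> l w _ _; rewrite /mxH; lia.
(* For [n < w] the first threshold is 0, so the right side is at least 2. Otherwise
   [thr2 A w.+1 <= l.+1] forces [thr1 A w <= l]. *)
- move=> l w hl hw; rewrite /mxH; case: (ltnP n w) => wn.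
    by have := thr1_gt0 w; lia.
  by have := thr1_lt_thr2 wn; lia.
Qed.

(** [thr1 A w < thr2 A w.+1 <= thr2 A w], so level 1 is reached first. *)
Lemma mxH_gt0 l w : w <= n -> (0 < mxH A l w) = (thr1 A w <= l).
Proof. by move=> hw; rewrite /mxH; move: (thr1_lt_thr2 hw) (thr2_anti w); lia. Qed.

Lemma mxH_gt1 l w : w <= n.+1 -> (1 < mxH A l w) = (thr2 A w <= l).
Proof.
case: w => [|w] hw.
  by rewrite /mxH; move: (thr1_lt_thr2 (leq0n n)) (thr2_anti 0); rewrite /thr1 /thr2 /=; lia.
by rewrite /mxH; move: (thr1_lt_thr2 hw) (thr1_anti w); lia.
Qed.
End MxH.

(** * Bijectivity of the passage from matrices to height functions *)

Lemma leq_eq_bounded m x y : (forall l, l <= m -> (x <= l) = (y <= l)) -> x <= m -> x = y.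
Proof.
move=> h xm; have yx : y <= x by rewrite -h.
by apply/eqP; rewrite eqn_leq yx andbT h //; apply: leq_trans yx xm.
Qed.

Lemma mxH_inj n r (A B : 'M['I_r.+2]_(2, n)) : A \in Mnk n r.+1 -> B \in Mnk n r.+1 ->
  (forall l w, l <= r.+2 -> w <= n.+2 -> mxH A l w = mxH B l w) -> A = B.
Proof.
move=> hA hB hAB; apply/matrixP => i j; apply/val_inj => /=; rewrite -!ent_ord.
have jn := ltn_ord j.
(* The level sets determine the thresholds, and at these [w] the thresholds are the entries of
   column [j], up to a successor in the second row. *)
have al : thr1 A (n - j) = thr1 B (n - j).
  apply: (@leq_eq_bounded r.+2); last by rewrite thr1_bot //; lia.
  by move=> l hl; rewrite -!mxH_gt0 ?leq_subr // hAB //; lia.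
have be : thr2 A (n.+1 - j) = thr2 B (n.+1 - j).
  apply: (@leq_eq_bounded r.+2); last by rewrite thr2_bot //; lia.
  by move=> l hl; rewrite -!mxH_gt1 ?leq_subr // hAB //; lia.
case: (eqVneq i ord0) => [->|i0].
  by move: al; rewrite /thr1 subn_eq0 leqNgt jn /= leq_subr subKn // ltnW.
have -> : i = ord_max by apply/val_inj; move: i0 (ltn_ord i); rewrite -val_eqE /=; lia.
move: be; rewrite /thr2 leq_subr subKn ?(leqW (ltnW jn)) //.
by rewrite leqNgt ltn_subRL addn1 ltnS jn /= => -[].
Qed.

Lemma find_iota_le (g : pred nat) m l : (forall i, i.+1 < m -> g i -> g i.+1) ->
  l < m -> (find g (iota 0 m) <= l) = g l.
Proof.
move=> mon lm; have mon' i j : i <= j < m -> g i -> g j.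
  move=> /andP[]; elim: j => [|j IH]; first by rewrite leqn0 => /eqP->.
  by rewrite leq_eqVlt => /orP[/eqP->//|ij jm gi]; apply/mon/IH => //; apply: ltnW.
case: (leqP (find g (iota 0 m)) l) => h.
  have hf : find g (iota 0 m) < size (iota 0 m) by rewrite size_iota (leq_ltn_trans h).
  apply/esym/(mon' (find g (iota 0 m))); first by rewrite h.
  rewrite -has_find in hf; have := nth_find 0 hf.
  by rewrite nth_iota // -[X in _ < X](size_iota 0 m) -has_find.
by have := before_find 0 h; rewrite nth_iota.
Qed.

Lemma find_iota_max (g : pred nat) m : find g (iota 0 m) <= m.
Proof. by rewrite -[X in _ <= X](size_iota 0 m) find_size. Qed.

Lemma mxH_surj n r (H : nat -> nat -> nat) : 0 < n -> height n r H ->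
  exists2 A : 'M['I_r.+2]_(2, n), A \in Mnk n r.+1 &
    forall l w, l <= r.+2 -> w <= n.+2 -> mxH A l w = H l w.
Proof.
move=> n0 hH.
(* A failed search returns [r.+1], the largest entry allowed; this is correct since [H r.+1 (n - j)]
   is positive and [H r.+2 (n.+1 - j)] is 2. The shift in [c2] reflects the strict inequality for
   the second row. *)
pose c1 j := find (fun l => 0 < H l (n - j)) (iota 0 r.+1).
pose c2 j := find (fun l => 1 < H l.+1 (n.+1 - j)) (iota 0 r.+1).
have c1P j l : j < n -> l <= r.+1 -> (c1 j <= l) = (0 < H l (n - j)).
  move=> hj; rewrite leq_eqVlt => /orP[/eqP->|hl].
    rewrite find_iota_max; apply/esym; rewrite -ltnS.
    apply: leq_trans (height_diag hH (leqnn _) _); last by lia.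
    by rewrite (height_bottom hH); lia.
  rewrite find_iota_le // => i hi h; apply: leq_trans h (height_col hH _ _); lia.
have c2P j l : j < n -> l <= r.+1 -> (c2 j <= l) = (1 < H l.+1 (n.+1 - j)).
  move=> hj; rewrite leq_eqVlt => /orP[/eqP->|hl].
    by rewrite find_iota_max (height_bottom hH) //; lia.
  rewrite find_iota_le // => i hi h; apply: leq_trans h (height_col hH _ _); lia.
pose A : 'M['I_r.+2]_(2, n) := (\matrix_(i, j) if i == ord0 then inord (c1 j) else inord (c2 j))%R.
have eA1 j : j < n -> ent A ord0 j = c1 j.
  by move=> hj; rewrite -[j]/(val (Ordinal hj)) ent_ord mxE eqxx inordK // ltnS find_iota_max.
have eA2 j : j < n -> ent A ord_max j = c2 j.
  by move=> hj; rewrite -[j]/(val (Ordinal hj)) ent_ord mxE /= inordK // ltnS find_iota_max.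
have hA : A \in Mnk n r.+1.
  apply/MnkP; have ex (i : 'I_2) : i = ord0 \/ i = ord_max.
    by case: i => [[|[|//]] hi]; [left|right]; apply/val_inj.
  have m1 j : c1 j <= r.+1 := find_iota_max _ _.
  have m2 j : c2 j <= r.+1 := find_iota_max _ _.
  split.
  (* Entries are positive: [H 0 (n - j)] is 0, hence [H 1 (n.+1 - j)] is at most 1 by
     [height_diag]. *)
  - move=> i j hj; case: (ex i) => ->; rewrite ?eA1 ?eA2 // ?m1 ?m2 andbT ltnNge ?c1P ?c2P //.
      by rewrite (height_top hH); lia.
    rewrite subSn ?(ltnW hj) //.
    by move: (height_diag hH (l := 0) (w := n - j)) (height_top hH (w := n - j)); lia.
  - move=> i j j' /andP[jj' hj']; have hj := leq_ltn_trans jj' hj'.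
    case: (ex i) => ->; rewrite ?eA1 ?eA2 //.
      rewrite (c1P _ _ hj (m1 j')).
      have hh : n - j' <= n - j <= n.+2 by lia.
      by apply: leq_trans (height_row_le hH (leqW (m1 j')) hh); rewrite -c1P.
    rewrite (c2P _ _ hj (m2 j')).
    have hh : n.+1 - j' <= n.+1 - j <= n.+2 by lia.
    have hc : (c2 j').+1 <= r.+2 := m2 j'.
    by apply: leq_trans (height_row_le hH hc hh); rewrite -c2P.
  (* Level 2 at [(l.+1, n.+1 - j)] forces level 1 at [(l, n - j)], by the diagonal condition. *)
  - move=> j hj; rewrite eA1 // eA2 // (c1P _ _ hj (m2 j)) -ltnS.
    have hh : n - j <= n.+1 by lia.
    by apply: leq_trans (height_diag hH (m2 j) hh); rewrite -subSn ?(ltnW hj) // -c2P.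
exists A => // l w; rewrite leq_eqVlt => /orP[/eqP->|hl] hw.
  by rewrite (height_bottom (mxH_height hA)) // (height_bottom hH).
have hl' := ltnW hl.
have E0 : (thr1 A w <= l) = (0 < H l w).
  rewrite /thr1; case: eqP => [->|w0]; first by rewrite (height_left hH) //; lia.
  case: (leqP w n) => wn; last first.
    have := height_col_le hH hw (l := 0) (l' := l) hl'; rewrite (height_top hH) // wn; lia.
  by rewrite eA1 ?c1P //; [congr (_ < H _ _)|..]; lia.
have E1 : (thr2 A w <= l) = (1 < H l w).
  (* For [w <= 1] level 2 is never reached: column 0 vanishes, and the diagonal condition bounds
     column 1 by 1. *)
  rewrite /thr2; case: (leqP w 1) => w1.
    case: w hw w1 {E0} => [|[|//]] hw _; first by rewrite (height_left hH) //; lia.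
    case: l hl hl' => [|l] hl hl'; first by rewrite (height_top hH) //; lia.
    have := height_diag hH (l := l) (w := 0); rewrite (height_left hH); lia.
  case: (leqP w n.+1) => wn; last first.
    by have -> : w = n.+2 by [lia]; rewrite (height_right hH).
  case: l hl hl' E0 => [|l] hl hl' _; first by rewrite (height_top hH) //; lia.
  by rewrite ltnS eA2 ?c2P //; [congr (_ < H _ _)|..]; lia.
by rewrite /mxH E0 E1; have := height_le2 hH hl' hw; lia.
Qed.

Lemma not_joined n r (M : {set {set Vtx n r}}) l w l' v : 0 < n -> 0 < r ->
  {in M, forall e, Gedge e} -> ~~ (exQ n r l w && exP n r l' v) ->
  joined M (Qc r l w) (Pc r l' v) = false.
Proof. by move=> n0 r0 hM; apply: contraNF => /(joined_ex n0 r0 hM)[-> ->]. Qed.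

(** * Height functions and perfect matchings *)

(* Only meant for p a valley and q an adjacent peak; l and w are then the indices of p. *)
Definition edgeval (r : nat) (H : nat -> nat -> nat) (p q : nat * nat) : bool :=
  let l := p.2 %/ 3 in
  let w := (p.1 + l - r.+1) %/ 2 in
  if q.2 == p.2.+2 then sel_down H l.+1 w
  else if q.1 == p.1.+1 then sel_right H l w else sel_left H l w.-1.

(** The congruence makes [x] the valley of the edge, as [edgeval] expects. *)
Definition kekule_of n r H : {set {set Vtx n r}} :=
  [set e | [exists x, exists y, [&& e == [set x; y], Gadj x y,
     (coords x).2 %% 3 == 1 & edgeval r H (coords x) (coords y)]]].

Lemma edgeval_down r H l w : l <= r.+1 -> edgeval r H (Qc r l w) (Pc r l.+1 w) = sel_down H l.+1 w.
Proof.
move=> hl; rewrite /edgeval /Qc /Pc /=.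
have -> : (3 * l + 1) %/ 3 = l by lia.
have -> : (2 * w + r.+1 - l + l - r.+1) %/ 2 = w by lia.
by case: eqP => //; lia.
Qed.

Lemma edgeval_right r H l w : l <= r.+1 -> edgeval r H (Qc r l w) (Pc r l w) = sel_right H l w.
Proof.
move=> hl; rewrite /edgeval /Qc /Pc /=.
have -> : (3 * l + 1) %/ 3 = l by lia.
have -> : (2 * w + r.+1 - l + l - r.+1) %/ 2 = w by lia.
by case: eqP => [|_]; [lia | case: eqP => //; lia].
Qed.

Lemma edgeval_left r H l w : l <= r.+1 -> edgeval r H (Qc r l w.+1) (Pc r l w) = sel_left H l w.
Proof.
move=> hl; rewrite /edgeval /Qc /Pc /=.
have -> : (3 * l + 1) %/ 3 = l by lia.
have -> : (2 * w.+1 + r.+1 - l + l - r.+1) %/ 2 = w.+1 by lia.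
by case: eqP => [|_]; [lia | case: eqP => [|//]; lia].
Qed.

Lemma kekule_of_Gedge n r H : {in kekule_of n r H, forall e, Gedge e}.
Proof.
move=> e; rewrite inE => /existsP[x /existsP[y /and4P[h1 h2 _ _]]].
by apply/existsP; exists x; apply/existsP; exists y; rewrite h1.
Qed.

Lemma joined_kekule_of n r H l w l' v : 0 < n -> 0 < r ->
  exQ n r l w -> exP n r l' v -> nQP l w l' v ->
  joined (kekule_of n r H) (Qc r l w) (Pc r l' v) = edgeval r H (Qc r l w) (Pc r l' v).
Proof.
move=> n0 r0 hq hp h; have [x ex] := Q_vtx hq; have [y ey] := P_vtx hp.
have xy := QP_Gadj n0 r0 hq hp h ex ey.
rewrite -ex -ey joinedE inE; apply/existsP/idP => [[a /existsP[b /and4P[/eqP eab _ ha hab]]]|hxy].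
  have xa : x = a.
    have := set22 x y; have := set21 x y; rewrite eab !inE => /orP[/eqP//|/eqP xb].
    case/orP => /eqP ye; last by case: (@Qc_neq_Pc r l w l' v); rewrite -ex -ey xb ye.
    by move: ha; rewrite -ye ey /=; lia.
  have yb : y = b by apply: (@set2_inj _ x); rewrite eab xa.
  by rewrite xa yb.
exists x; apply/existsP; exists y; rewrite eqxx xy hxy ex /Qc /=.
by rewrite andbT /=; lia.
Qed.

(* The valleys that [exQ] excludes are those with a forced vertical edge. *)
Lemma sel_down_missing n r H l w : height n r H ->
  l <= r.+1 -> w <= n.+1 -> ~~ exQ n r l w -> sel_down H l.+1 w.
Proof.
move=> hH hl hw hn.
have [[-> ->]|[-> ->]|[-> ->]|[-> ->]] :
   [\/ l = 0 /\ w = n.+1, l = r /\ w = 0, l = r.+1 /\ w = 0 | l = r.+1 /\ w = 1].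
  move: hn; rewrite /exQ => hn.
  have : [|| (l == 0) && (w == n.+1), (l == r) && (w == 0), (l == r.+1) && (w == 0)
    | (l == r.+1) && (w == 1)] by lia.
  by case/or4P => /andP[/eqP-> /eqP->]; [apply: Or41|apply: Or42|apply: Or43|apply: Or44].
- rewrite /sel_down (height_right hH) //.
  by move: (height_diag hH (l := 0) (w := n)) (height_top hH (w := n)); lia.
- rewrite /sel_down (height_left hH (leqnSn r.+1)).
  by move: (height_diag hH (l := r.+1) (w := 1)) (height_bottom hH (w := 2)); lia.
- by rewrite /sel_down !(height_bottom hH).
- by rewrite /sel_down !(height_bottom hH).
Qed.

(** A row rises by at most 1 at each step: [H l w.+1 <= H l.+1 w.+1 <= (H l w).+1]. The last row has
    no successor and is read off its boundary values. *)
Lemma heightS n r H l w : height n r H -> l <= r.+2 -> w <= n.+1 ->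
  H l w.+1 = H l w + sel_down H l w.
Proof.
move=> hH; rewrite leq_eqVlt => /orP[/eqP->|hl] hw.
  by rewrite /sel_down !(height_bottom hH); lia.
rewrite /sel_down; move: (height_row hH (ltnW hl) hw) (height_col hH hl (w := w.+1) hw).
by move: (height_diag hH hl hw); lia.
Qed.

Section KekuleOf.

Variables (n r : nat) (H : nat -> nat -> nat).
Hypotheses (n0 : 0 < n) (r0 : 0 < r) (hH : height n r H).

Local Notation M := (kekule_of n r H).

Let hM := @kekule_of_Gedge n r H.

Lemma kekule_of_down l w : exQ n r l w -> joined M (Qc r l w) (Pc r l.+1 w) = sel_down H l.+1 w.
Proof.
move=> hq; have hl : l <= r.+1 by case/and4P: hq.
have [hp|hp] := boolP (exP n r l.+1 w).
  by rewrite joined_kekule_of ?edgeval_down // /nQP !eqxx.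
rewrite (not_joined n0 r0 hM) ?(negbTE hp) ?andbF //; have [-> hw] : l = r.+1 /\ 1 < w <= n.+1.
  by move: hq hp; rewrite /exQ /exP; lia.
by rewrite /sel_down !(height_bottom hH); lia.
Qed.

Lemma kekule_of_right l w : exQ n r l w || exP n r l w ->
  joined M (Qc r l w) (Pc r l w) = sel_right H l w.
Proof.
move=> h; have [/andP[hq hp]|hn] := boolP (exQ n r l w && exP n r l w).
  by rewrite joined_kekule_of ?edgeval_right //; [case/and4P: hq | rewrite /nQP !eqxx orbT].
rewrite (not_joined n0 r0 hM) //; apply/esym/negbTE; rewrite /sel_right -ltnNge.
(* The four positions where just one end of the slanted edge belongs to the graph. *)
have [[-> ->]|[-> ->]|[-> ->]|[-> ->]] :
   [\/ l = 0 /\ w = n, l = 1 /\ w = n.+1, l = r /\ w = 0 | l = r.+1 /\ w = 1].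
  move: h hn; rewrite /exQ /exP => h hn.
  have : [|| (l == 0) && (w == n), (l == 1) && (w == n.+1), (l == r) && (w == 0)
    | (l == r.+1) && (w == 1)] by lia.
  by case/or4P => /andP[/eqP-> /eqP->]; [apply: Or41|apply: Or42|apply: Or43|apply: Or44].
- by move: (height_col hH (l := 0) (w := n.+1)) (height_top hH (w := n))
      (height_top hH (w := n.+1)); lia.
- move: (height_diag hH (l := 0) (w := n)) (height_top hH (w := n)).
  by rewrite (height_right hH (l := 2)) //; lia.
- rewrite (height_left hH) ?leqW //.
  by move: (height_diag hH (l := r.+1) (w := 1)) (height_bottom hH (w := 2)); lia.
- move: (height_diag hH (l := r) (w := 0)) (height_bottom hH (w := 2)).
  by have := height_left hH (l := r); lia.
Qed.

Lemma kekule_of_left l w : exQ n r l w.+1 || exP n r l w ->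
  joined M (Qc r l w.+1) (Pc r l w) = sel_left H l w.
Proof.
move=> h; have [/andP[hq hp]|hn] := boolP (exQ n r l w.+1 && exP n r l w).
  by rewrite joined_kekule_of ?edgeval_left //; [case/and4P: hq | rewrite /nQP !eqxx !orbT].
(* The only failure is to the right of the last peak, where the height is constantly 2. *)
have [hl ->] : l <= r.+1 /\ w = n.+1 by move: h hn; rewrite /exQ /exP; lia.
rewrite (not_joined n0 r0 hM); last by rewrite /exQ; lia.
by rewrite /sel_left (height_right hH (leqW hl)) (height_right hH (l := l.+1)).
Qed.

Lemma kekule_of_kekule : kekule M.
Proof.
apply/(kekule_deg n0 r0 hM); split=> l w h.
  have /and4P[hl hw _ _] := h.
  rewrite -[RHS](height_valley hH hl hw) kekule_of_down // kekule_of_right ?h //.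
  by case: w h hw => // w h hw; rewrite kekule_of_left ?h.
have /and4P[hl hw hwn _] := h.
rewrite -[RHS](height_peak hH hl hw) kekule_of_right ?h ?orbT // kekule_of_left ?h ?orbT //.
(* Peaks of zigzag 0 have index below [n], where row 0 does not rise. *)
case: l h hl hwn => [|l] h hl hwn; first by rewrite /sel_down !(height_top hH); lia.
by rewrite kekule_of_down //; move: h; rewrite /exQ /exP; lia.
Qed.

End KekuleOf.

(** Rows are rebuilt from left to right: each increment is a vertical edge of the matching or a
    forced one. *)
Lemma kekule_of_inj n r H H' : 0 < n -> 0 < r -> height n r H -> height n r H' ->
  kekule_of n r H = kekule_of n r H' ->
  forall l w, l <= r.+2 -> w <= n.+2 -> H l w = H' l w.
Proof.
move=> n0 r0 hH hH' e [|l] w hl; first by move=> hw; rewrite !(height_top hH, height_top hH').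
elim: w => [|w IH] hw; first by rewrite (height_left hH) // (height_left hH').
rewrite (heightS hH) // (heightS hH') // IH 1?ltnW //.
have [hq|hq] := boolP (exQ n r l w).
  by rewrite -(kekule_of_down n0 r0 hH hq) e (kekule_of_down n0 r0 hH' hq).
by rewrite (sel_down_missing hH hl hw hq) (sel_down_missing hH' hl hw hq).
Qed.

Lemma kekule_of_surj n r (M : {set {set Vtx n r}}) : 0 < n -> 0 < r -> kekule M ->
  exists2 H, height n r H & kekule_of n r H = M.
Proof.
move=> n0 r0 kM; have hM : {in M, forall e, Gedge e} by case/andP: kM => /forall_inP.
have [hQ hP] := (kekule_deg n0 r0 hM).1 kM.
have nex := not_joined n0 r0 hM.
(* The disjunct [~~ exQ] and the value at l = 0 are the forced vertical edges. *)
pose V l w := if l is l'.+1 then joined M (Qc r l' w) (Pc r l w) || ~~ exQ n r l' w else n <= w.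
pose a l w := joined M (Qc r l w.+1) (Pc r l w).
pose b l w := joined M (Qc r l w) (Pc r l w).
have Vbot w : w <= n.+1 -> V r.+2 w = (w <= 1).
  by move=> hw; rewrite /V nex /exQ /exP; lia.
have cP l w : l <= r.+1 -> w <= n.+1 -> V l w + b l w + a l w = 1.
  move=> hl hw; have [hp|hp] := boolP (exP n r l w).
    rewrite -(hP _ _ hp) /a /b /V; case: l hl hp => [|l] hl hp.
      by move: hp; rewrite /exP; lia.
    by have -> : exQ n r l w by [move: hp; rewrite /exQ /exP; lia]; rewrite orbF.
  (* A missing peak carries a forced vertical edge and no slanted one. *)
  rewrite /a /b !nex ?(negbTE hp) ?andbF // !addn0 /V.
  case: l hl hp => [|l] hl hp; first by move: hp; rewrite /exP; lia.
  by rewrite nex ?(negbTE hp) ?andbF //=; move: hp; rewrite /exQ /exP; lia.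
have cQ l w : l <= r.+1 -> w <= n.+1 ->
    V l.+1 w + b l w + (if w is w'.+1 then a l w' : nat else 0) = 1.
  move=> hl hw; have [hq|hq] := boolP (exQ n r l w).
    by rewrite -(hQ _ _ hq) /a /b /V hq orbF; case: w {hq hw}.
  rewrite /V hq orbT /b nex ?(negbTE hq) //.
  by case: w hw hq => // w hw hq; rewrite /a nex ?(negbTE hq).
have hH : height n r (heights_of V) by apply: heights_of_height cQ.
exists (heights_of V) => //.
apply: (eq_joined n0 r0 (@kekule_of_Gedge n r _) hM) => l w l' v h1 h2 h3.
have /and4P[hl hw _ _] := h1.
rewrite joined_kekule_of //; case: (nQP_cases h3) => -[e1 e2]; subst.
- by rewrite edgeval_down // heights_of_down /V h1 orbF.
- by rewrite edgeval_right // (heights_of_right cP cQ).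
- by rewrite edgeval_left // (heights_of_left cP cQ) // ltnW.
Qed.

Lemma eq_kekule_of n r H H' : 0 < n -> 0 < r ->
  (forall l w, l <= r.+2 -> w <= n.+2 -> H l w = H' l w) ->
  kekule_of n r H = kekule_of n r H'.
Proof.
move=> n0 r0 eH; have hM H0 := @kekule_of_Gedge n r H0.
apply: (eq_joined n0 r0 (hM H) (hM H')) => l w l' v h1 h2 h3.
have /and4P[hl hw _ _] := h1.
rewrite !joined_kekule_of //; case: (nQP_cases h3) => -[e1 e2]; subst.
- by rewrite !edgeval_down // /sel_down !eH // ltnW.
- by rewrite !edgeval_right // /sel_right !eH // ltnW.
- by rewrite !edgeval_left // /sel_left !eH // ltnW.
Qed.

Theorem theorem1 (n k : nat) (hn : 1 <= n) (hk : 2 <= k) :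
  (exists f : 'M['I_k.+1]_(2, n) -> {set {set Vtx n (k - 1)}},
      {in Mnk n k &, injective f} /\ f @: Mnk n k = Kekule n (k - 1))
  /\ #|Mnk n k| = #|Kekule n (k - 1)|.
Proof.
case: k hk => [//|r] r0; rewrite subn1 /=.
pose f (A : 'M['I_r.+2]_(2, n)) := kekule_of n r (mxH A).
have f_inj : {in Mnk n r.+1 &, injective f}.
  move=> A B hA hB /(kekule_of_inj hn r0 (mxH_height hA) (mxH_height hB)).
  exact: mxH_inj.
have f_im : f @: Mnk n r.+1 = Kekule n r.
  apply/setP => M; rewrite inE; apply/imsetP/idP => [[A hA ->]|].
    exact: kekule_of_kekule (mxH_height hA).
  case/(kekule_of_surj hn r0) => H hH <-.
  have [A hA eA] := mxH_surj hn hH; exists A => //.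
  exact/esym/eq_kekule_of.
by split; [exists f | rewrite -f_im card_in_imset].
Qed.
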